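(* Let $(A,\ast,\curlyvee,\diamond,\bullet)$ be an NS-Poisson algebra. For $x,y\in A$ put $x\odot y=x\ast y+y\ast x+x\curlyvee y$ and $\{\!\!\{x,y\}\!\!\}=x\diamond y-y\diamond x+x\bullet y$. (i) Then $(A,\odot,\{\!\!\{~,~\}\!\!\})$ is a Poisson algebra (called the sub-adjacent Poisson algebra $A^c$). (ii) Moreover, the triple $(A,\mu,\rho)$ is a representation of the Poisson algebra $A^c=(A,\odot,\{\!\!\{~,~\}\!\!\})$, where $\mu,\rho:A\to\mathrm{End}(A)$ are given by $\mu_x(y)=x\ast y$ and $\rho_x(y)=x\diamond y$ for $x,y\in A$.
   Context: All vector spaces and (multi)linear maps are over a field $\mathbf{k}$ of characteristic $0$. Associative algebras are not required to be unital. An NS-commutative algebra is a triple $(A,\ast,\curlyvee)$ of a vector space $A$ with bilinear operations $\ast,\curlyvee:A\times A\to A$, where $\curlyvee$ is commutative, such that for all $x,y,z\in A$, with $x\odot y=x\ast y+y\ast x+x\curlyvee y$: $$x\ast(y\ast z)=(x\odot y)\ast z,\qquad x\ast(y\curlyvee z)+x\curlyvee(y\odot z)=y\ast(x\curlyvee z)+y\curlyvee(x\odot z).$$ An NS-Lie algebra is a triple $(A,\diamond,\bullet)$ of a vector space $A$ with bilinear operations $\diamond,\bullet:A\times A\to A$, where $\bullet$ is skew-symmetric, such that for all $x,y,z\in A$, with $\{\!\!\{x,y\}\!\!\}=x\diamond y-y\diamond x+x\bullet y$: $$x\diamond(y\diamond z)-(x\diamond y)\diamond z-y\diamond(x\diamond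 z)+(y\diamond x)\diamond z=(x\bullet y)\diamond z,$$ $$x\bullet\{\!\!\{y,z\}\!\!\}+y\bullet\{\!\!\{z,x\}\!\!\}+z\bullet\{\!\!\{x,y\}\!\!\}+x\diamond(y\bullet z)+y\diamond(z\bullet x)+z\diamond(x\bullet y)=0.$$ An NS-Poisson algebra is a quintuple $(A,\ast,\curlyvee,\diamond,\bullet)$ such that $(A,\ast,\curlyvee)$ is an NS-commutative algebra, $(A,\diamond,\bullet)$ is an NS-Lie algebra, and for all $x,y,z\in A$, with $x\odot y=x\ast y+y\ast x+x\curlyvee y$ and $\{\!\!\{x,y\}\!\!\}=x\diamond y-y\diamond x+x\bullet y$: $$\{\!\!\{x,y\}\!\!\}\ast z=x\diamond(y\ast z)-y\ast(x\diamond z),$$ $$(x\odot y)\diamond z=x\ast(y\diamond z)+y\ast(x\diamond z),$$ $$x\bullet(y\odot z)+x\diamond(y\curlyvee z)=\{\!\!\{x,y\}\!\!\}\curlyvee z+z\ast(x\bullet y)+y\curlyvee\{\!\!\{x,z\}\!\!\}+y\ast(x\bullet z).$$ A Poisson algebra is a triple $(A,\cdot,\{~,~\})$ with $(A,\cdot)$ a commutative associative algebra and $\{~,~\}$ a Lie bracket on $A$ satisfying $\{x,y\cdot z\}=\{x,y\}\cdot z+y\cdot\{x,z\}$. A representation of a Poisson algebra $(A,\cdot,\{~,~\})$ is a triple $(V,\mu,\rho)$ where $(V,\mu)$ is a representation of the commutative associative algebra $(A,\cdot)$ (i.e. $\mu:A\to\mathrm{End}(V)$ is linear with $\mu_{x\cdot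 y}=\mu_x\circ\mu_y$), $(V,\rho)$ is a representation of the Lie algebra $(A,\{~,~\})$, and for all $x,y\in A$: $\rho_x\circ\mu_y-\mu_y\circ\rho_x-\mu_{\{x,y\}}=0$ and $\mu_x\circ\rho_y+\mu_y\circ\rho_x-\rho_{x\cdot y}=0$. *)

(* Defs.v *)
From mathcomp Require Import all_boot all_algebra.

Set Implicit Arguments.
Unset Strict Implicit.
Unset Printing Implicit Defensive.

Import GRing.Theory.
Local Open Scope ring_scope.

Definition is_bilinear (k : fieldType) (U V W : lmodType k)
    (f : U -> V -> W) : Prop :=
  (forall v, linear (f ^~ v)) /\ (forall u, linear (f u)).

Section Algebras.
Variables (k : fieldType) (A : lmodType k).

Record comm_assoc_algebra (dot : A -> A -> A) : Prop := CommAssocAlgebra {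
  caa_bilinear : is_bilinear dot;
  caa_comm : commutative dot;
  caa_assoc : associative dot
}.

(* Alternating rather than skew-symmetric: over a field of characteristic 0 the
   two conditions agree. *)
Record lie_algebra (br : A -> A -> A) : Prop := LieAlgebra {
  lie_bilinear : is_bilinear br;
  lie_alternating : forall x, br x x = 0;
  lie_jacobi : forall x y z,
    br x (br y z) + br y (br z x) + br z (br x y) = 0
}.

Record poisson_algebra (dot br : A -> A -> A) : Prop := PoissonAlgebra {
  poisson_comm_assoc : comm_assoc_algebra dot;
  poisson_lie : lie_algebra br;
  poisson_leibniz : forall x y z,
    br x (dot y z) = dot (br x y) z + dot y (br x z)
}.

End Algebras.

(* A linear map A -> End(V) is given in uncurried form, as a bilinear map
   A -> V -> V. *)
Section Representations.
Variables (k : fieldType) (A V : lmodType k).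

Record comm_assoc_representation (dot : A -> A -> A) (mu : A -> V -> V)
    : Prop := CommAssocRepresentation {
  car_bilinear : is_bilinear mu;
  car_mul : forall x y, mu (dot x y) =1 mu x \o mu y
}.

Record lie_representation (br : A -> A -> A) (rho : A -> V -> V)
    : Prop := LieRepresentation {
  lr_bilinear : is_bilinear rho;
  lr_bracket : forall x y v,
    rho (br x y) v = rho x (rho y v) - rho y (rho x v)
}.

Record poisson_representation (dot br : A -> A -> A) (mu rho : A -> V -> V)
    : Prop := PoissonRepresentation {
  pr_comm_assoc : comm_assoc_representation dot mu;
  pr_lie : lie_representation br rho;
  pr_bracket : forall x y v,
    rho x (mu y v) - mu y (rho x v) - mu (br x y) v = 0;
  pr_mul : forall x y v,
    mu x (rho y v) + mu y (rho x v) - rho (dot x y) v = 0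
}.

End Representations.

(* ast, cv, dia, bul stand for the operations $\ast$, $\curlyvee$, $\diamond$,
   $\bullet$; ns_dot is $\odot$ and ns_bracket the double-brace bracket. *)
Section NSAlgebras.
Variables (k : fieldType) (A : lmodType k).

Definition ns_dot (ast cv : A -> A -> A) (x y : A) : A :=
  ast x y + ast y x + cv x y.

Definition ns_bracket (dia bul : A -> A -> A) (x y : A) : A :=
  dia x y - dia y x + bul x y.

Record ns_commutative_algebra (ast cv : A -> A -> A) : Prop :=
  NSCommutativeAlgebra {
  nsc_ast_bilinear : is_bilinear ast;
  nsc_cv_bilinear : is_bilinear cv;
  nsc_cv_comm : commutative cv;
  nsc_ast_ast : forall x y z,
    ast x (ast y z) = ast (ns_dot ast cv x y) z;
  nsc_ast_cv : forall x y z,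
    ast x (cv y z) + cv x (ns_dot ast cv y z)
    = ast y (cv x z) + cv y (ns_dot ast cv x z)
}.

Record ns_lie_algebra (dia bul : A -> A -> A) : Prop := NSLieAlgebra {
  nsl_dia_bilinear : is_bilinear dia;
  nsl_bul_bilinear : is_bilinear bul;
  nsl_bul_skew : forall x y, bul x y = - bul y x;
  nsl_dia_dia : forall x y z,
    dia x (dia y z) - dia (dia x y) z - dia y (dia x z) + dia (dia y x) z
    = dia (bul x y) z;
  nsl_bul_cyclic : forall x y z,
    bul x (ns_bracket dia bul y z) + bul y (ns_bracket dia bul z x)
    + bul z (ns_bracket dia bul x y)
    + dia x (bul y z) + dia y (bul z x) + dia z (bul x y) = 0
}.

Record ns_poisson_algebra (ast cv dia bul : A -> A -> A) : Prop :=
  NSPoissonAlgebra {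
  nsp_comm : ns_commutative_algebra ast cv;
  nsp_lie : ns_lie_algebra dia bul;
  nsp_bracket_ast : forall x y z,
    ast (ns_bracket dia bul x y) z = dia x (ast y z) - ast y (dia x z);
  nsp_dot_dia : forall x y z,
    dia (ns_dot ast cv x y) z = ast x (dia y z) + ast y (dia x z);
  nsp_bul_dot : forall x y z,
    bul x (ns_dot ast cv y z) + dia x (cv y z)
    = cv (ns_bracket dia bul x y) z + ast z (bul x y)
      + cv y (ns_bracket dia bul x z) + ast y (bul x z)
}.

End NSAlgebras.

(* Main.v *)
Require Import Defs.
From mathcomp Require Import all_boot all_algebra.

(** Besides bilinearity and the symmetry of [cv] and [bul], the identities of an
    NS-Poisson algebra are of two kinds.  Four of them say, after collecting
    terms by bilinearity, that left multiplication by [ast] and by [dia]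
    represents the sub-adjacent product and bracket on [A]; this is the
    representation claim.  The other three, [nsc_ast_cv], [nsl_bul_cyclic] and
    [nsp_bul_dot], are cocycle conditions on [cv] and [bul].

    For the Poisson axioms, expand a nested sub-adjacent product such as
    [ns_dot x (ns_dot y z)].  One of its terms, [ast (ns_dot y z) x], has the
    inner product acting on the left, and the representation identity turns it
    into nested left multiplications.  What remains is a cocycle expression plus
    a combination of nested left multiplications, and the latter is symmetric
    in two arguments (associativity, [ns_dot_nested]), telescopes around the
    cycle (Jacobi, [ns_bracket_nested]) or cancels up to terms present on both
    sides (Leibniz, [ns_dot_bracketl]).

    Characteristic 0 is what makes the skew-symmetric [bul] alternating. *)

Set Implicit Arguments.
Unset Strict Implicit.
Unset Printing Implicit Defensive.

Import GRing.Theory.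
Local Open Scope ring_scope.

Section Bilinear.
Variables (k : fieldType) (U V W : lmodType k).
Implicit Types f g : U -> V -> W.

Lemma bilinearDl f : is_bilinear f ->
  forall u u' v, f (u + u') v = f u v + f u' v.
Proof.
by case=> fl _ u u' v; have := fl v 1 u u'; rewrite !scale1r.
Qed.

Lemma bilinearDr f : is_bilinear f ->
  forall u v v', f u (v + v') = f u v + f u v'.
Proof.
by case=> _ fr u v v'; have := fr u 1 v v'; rewrite !scale1r.
Qed.

Lemma bilinearBl f : is_bilinear f ->
  forall u u' v, f (u - u') v = f u v - f u' v.
Proof.
case=> fl _ u u' v; have /= := fl v (-1) u' u.
by rewrite !scaleN1r (addrC u) => ->; rewrite addrC.
Qed.

Lemma bilinearBr f : is_bilinear f ->
  forall u v v', f u (v - v') = f u v - f u v'.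
Proof.
case=> _ fr u v v'; have := fr u (-1) v' v.
by rewrite !scaleN1r (addrC v) => ->; rewrite addrC.
Qed.

Lemma is_bilinearD f g : is_bilinear f -> is_bilinear g ->
  is_bilinear (fun u v => f u v + g u v).
Proof.
move=> [fl fr] [gl gr]; split=> [v|u] a w w' /=.
  by rewrite (fl v a) (gl v a) scalerDr addrACA.
by rewrite (fr u a) (gr u a) scalerDr addrACA.
Qed.

Lemma is_bilinearB f g : is_bilinear f -> is_bilinear g ->
  is_bilinear (fun u v => f u v - g u v).
Proof.
move=> [fl fr] [gl gr]; split=> [v|u] a w w' /=.
  by rewrite (fl v a) (gl v a) scalerBr opprD addrACA.
by rewrite (fr u a) (gr u a) scalerBr opprD addrACA.
Qed.

End Bilinear.

Lemma is_bilinear_swap (k : fieldType) (U V W : lmodType k) (f : U -> V -> W) :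
  is_bilinear f -> is_bilinear (fun v u => f u v).
Proof. by case. Qed.

Lemma eq_opp_pchar0 (k : fieldType) (A : lmodType k) (v : A) :
  has_pchar0 k -> v = - v -> v = 0.
Proof.
move=> char_k vN; apply/eqP.
have : v *+ 2 == 0 by rewrite mulr2n {1}vN addNr.
by rewrite -scaler_nat scaler_eq0 ((pcharf0P k).1 char_k).
Qed.

Lemma telescope_cycle3 (A : zmodType) (a b c : A) :
  (a - b) + (b - c) + (c - a) = 0.
Proof. by rewrite !subrKA subrr. Qed.

Lemma sum3D (A : zmodType) (a b a' b' a'' b'' : A) :
  (a + b) + (a' + b') + (a'' + b'') = (a + a' + a'') + (b + b' + b'').
Proof. by rewrite (addrACA a) [LHS]addrACA. Qed.

Section NSCommutative.
Variables (k : fieldType) (A : lmodType k) (ast cv : A -> A -> A).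
Hypothesis nsA : ns_commutative_algebra ast cv.

Let ast_bilinear := nsc_ast_bilinear nsA.

Lemma ns_dot_bilinear : is_bilinear (ns_dot ast cv).
Proof.
apply: is_bilinearD (nsc_cv_bilinear nsA).
exact: is_bilinearD ast_bilinear (is_bilinear_swap ast_bilinear).
Qed.

Lemma ns_dotC : commutative (ns_dot ast cv).
Proof.
by move=> x y; rewrite /ns_dot (nsc_cv_comm nsA) (addrC (ast x y)).
Qed.

(** Each of the three summands is symmetric in [x] and [y]: the first because
    the product commutes, the second visibly, the third by the cocycle
    identity. *)
Lemma ns_dot_nested x y z :
  ns_dot ast cv x (ns_dot ast cv y z)
  = ast (ns_dot ast cv x y) z + (ast x (ast z y) + ast y (ast z x))
    + (ast x (cv y z) + cv x (ns_dot ast cv y z)).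
Proof.
rewrite [LHS]/ns_dot -/(ns_dot ast cv y z) -!(nsc_ast_ast nsA).
rewrite {1}/ns_dot !(bilinearDr ast_bilinear).
by rewrite -!addrA; do 2!congr (_ + _); rewrite addrCA.
Qed.

(** For a commutative product, associativity amounts to this identity, which
    is the form that matches the symmetry of [nsc_ast_cv]. *)
Lemma ns_dot_left_comm : left_commutative (ns_dot ast cv).
Proof.
move=> x y z; rewrite !ns_dot_nested (nsc_ast_cv nsA) (ns_dotC x y).
by rewrite (addrC (ast x (ast z y))).
Qed.

Lemma ns_dot_comm_assoc : comm_assoc_algebra (ns_dot ast cv).
Proof.
split; [exact: ns_dot_bilinear | exact: ns_dotC |] => x y z.
by rewrite (ns_dotC y) ns_dot_left_comm ns_dotC.
Qed.

Lemma ast_representation : comm_assoc_representation (ns_dot ast cv) ast.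
Proof.
by split=> // x y v /=; rewrite (nsc_ast_ast nsA).
Qed.

End NSCommutative.

Section NSLie.
Variables (k : fieldType) (A : lmodType k) (dia bul : A -> A -> A).
Hypothesis nsA : ns_lie_algebra dia bul.

Let dia_bilinear := nsl_dia_bilinear nsA.

Lemma ns_bracket_bilinear : is_bilinear (ns_bracket dia bul).
Proof.
apply: is_bilinearD (nsl_bul_bilinear nsA).
exact: is_bilinearB dia_bilinear (is_bilinear_swap dia_bilinear).
Qed.

Lemma dia_representation : lie_representation (ns_bracket dia bul) dia.
Proof.
split=> // x y v.
rewrite (bilinearDl dia_bilinear) (bilinearBl dia_bilinear) -(nsl_dia_dia nsA).
by rewrite !addrA [LHS](ACl (3 * 5 * 1 * 4 * 6 * 2)) /= !addrK.
Qed.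

(** The nested [dia] terms are paired so that each pair is a difference of two
    consecutive cyclic permutations of one expression: in a cyclic sum both
    pairs telescope, and the first summand vanishes by [nsl_bul_cyclic]. *)
Lemma ns_bracket_nested x y z :
  ns_bracket dia bul x (ns_bracket dia bul y z)
  = (bul x (ns_bracket dia bul y z) + dia x (bul y z))
    + ((dia x (dia y z) - dia y (dia z x))
       + (dia z (dia y x) - dia x (dia z y))).
Proof.
rewrite [LHS]/ns_bracket -/(ns_bracket dia bul y z).
rewrite (lr_bracket dia_representation).
rewrite (bilinearDr dia_bilinear) (bilinearBr dia_bilinear) opprB.
by rewrite !addrA [LHS](ACl ((6 * 3) * ((1 * 5) * (4 * 2)))) /= !addrA.
Qed.

Lemma ns_bracket_jacobi x y z :
  ns_bracket dia bul x (ns_bracket dia bul y z)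
  + ns_bracket dia bul y (ns_bracket dia bul z x)
  + ns_bracket dia bul z (ns_bracket dia bul x y) = 0.
Proof.
rewrite !ns_bracket_nested sum3D [X in _ + X]sum3D !telescope_cycle3 !addr0.
rewrite sum3D addrA addrA.
exact: nsl_bul_cyclic.
Qed.

Lemma ns_bracket_alternating (char_k : has_pchar0 k) x :
  ns_bracket dia bul x x = 0.
Proof.
rewrite /ns_bracket subrr add0r.
exact: eq_opp_pchar0 char_k (nsl_bul_skew nsA x x).
Qed.

Lemma ns_bracket_lie (char_k : has_pchar0 k) :
  lie_algebra (ns_bracket dia bul).
Proof.
split; [exact: ns_bracket_bilinear | exact: ns_bracket_alternating |].
exact: ns_bracket_jacobi.
Qed.

End NSLie.

Section NSPoisson.
Variables (k : fieldType) (A : lmodType k) (ast cv dia bul : A -> A -> A).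
Hypothesis nsA : ns_poisson_algebra ast cv dia bul.

Let ast_bilinear := nsc_ast_bilinear (nsp_comm nsA).
Let dia_bilinear := nsl_dia_bilinear (nsp_lie nsA).

(** The middle difference is antisymmetric in [y] and [z], so it disappears
    from the sum that forms the right-hand side of the Leibniz rule. *)
Lemma ns_dot_bracketl x y z :
  ns_dot ast cv (ns_bracket dia bul x y) z
  = (dia x (ast y z) - ast z (dia y x)) + (ast z (dia x y) - ast y (dia x z))
    + (cv (ns_bracket dia bul x y) z + ast z (bul x y)).
Proof.
rewrite [LHS]/ns_dot (nsp_bracket_ast nsA) {1}/ns_bracket.
rewrite (bilinearDr ast_bilinear) (bilinearBr ast_bilinear).
by rewrite !addrA [LHS](ACl (1 * 4 * 3 * 2 * 6 * 5)).
Qed.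

Lemma ns_leibniz x y z :
  ns_bracket dia bul x (ns_dot ast cv y z)
  = ns_dot ast cv (ns_bracket dia bul x y) z
    + ns_dot ast cv y (ns_bracket dia bul x z).
Proof.
rewrite (ns_dotC (nsp_comm nsA) y (ns_bracket _ _ _ _)) !ns_dot_bracketl.
rewrite [RHS]addrACA.
rewrite (nsc_cv_comm (nsp_comm nsA) _ y) [X in _ = _ + X]addrA
  -(nsp_bul_dot nsA).
(* The antisymmetric differences cancel here. *)
rewrite [X in _ = X + _]addrACA subrKA subrr addr0.
rewrite [LHS]/ns_bracket (nsp_dot_dia nsA) opprD.
rewrite {1}/ns_dot !(bilinearDr dia_bilinear).
by rewrite !addrA [LHS](ACl (1 * 5 * 2 * 4 * 6 * 3)).
Qed.

Lemma ns_sub_adjacent_poisson (char_k : has_pchar0 k) :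
  poisson_algebra (ns_dot ast cv) (ns_bracket dia bul).
Proof.
split; last exact: ns_leibniz.
  exact: ns_dot_comm_assoc (nsp_comm nsA).
exact: ns_bracket_lie (nsp_lie nsA) char_k.
Qed.

Lemma ns_sub_adjacent_representation :
  poisson_representation (ns_dot ast cv) (ns_bracket dia bul) ast dia.
Proof.
split=> [||x y v|x y v].
- exact: ast_representation (nsp_comm nsA).
- exact: dia_representation (nsp_lie nsA).
- by rewrite (nsp_bracket_ast nsA) subrr.
- by rewrite (nsp_dot_dia nsA) subrr.
Qed.

End NSPoisson.

Theorem theorem3p3 (k : fieldType) (char_k : has_pchar0 k) (A : lmodType k)
    (ast cv dia bul : A -> A -> A)
    (nsA : ns_poisson_algebra ast cv dia bul) :
  poisson_algebra (ns_dot ast cv) (ns_bracket dia bul) /\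
  poisson_representation (ns_dot ast cv) (ns_bracket dia bul)
    (fun x y : A => ast x y) (fun x y : A => dia x y).
Proof.
split; first exact: ns_sub_adjacent_poisson nsA char_k.
exact: ns_sub_adjacent_representation nsA.
Qed.
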